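(* Let $n\ge1$ and let $\mathcal{K}\subset\mathbb{R}^n$ be a closed convex centrally symmetric body with positive measure, with polar body $\mathcal{K}^o$. Suppose a closed convex centrally symmetric body $\mathcal{S}\subset\mathbb{R}^n$ contains a point $x_0$ with $\|x_0\|_{\mathcal{K}^o}=\pi/2$. Then there exist a set $\Lambda\subset\mathbb{R}^n$ with $\Lambda+\mathcal{S}=\mathbb{R}^n$ and a function $f\in B_{\mathcal{K}}$, not identically zero, such that $f(\lambda)=0$ for all $\lambda\in\Lambda$.
   Context: A ''closed convex centrally symmetric body'' is a compact convex set $A\subset\mathbb{R}^n$ with nonempty interior and $A=-A$. The polar body of $\mathcal{K}$ is $\mathcal{K}^o:=\{x\in\mathbb{R}^n: x\cdot t\le 1\text{ for all }t\in\mathcal{K}\}$, and $\|x\|_{\mathcal{K}^o}:=\inf\{a>0: x\in a\mathcal{K}^o\}$. For sets, $A+B=\{a+b: a\in A,\ b\in B\}$ and $aA=\{ax: x\in A\}$. For a compact set $\mathcal{K}\subset\mathbb{R}^n$, the Bernstein space $B_{\mathcal{K}}$ consists of all bounded continuous functions $f:\mathbb{R}^n\to\mathbb{C}$ whose spectrum belongs to $\mathcal{K}$, meaning that $\int_{\mathbb{R}^n}f(x)\hat\varphi(x)\,dx=0$ for every smooth function $\varphi$ whose support belongs to a ball disjoint from $\mathcal{K}$, where $\hat\varphi(x)=\int_{\mathbb{R}^n}e^{-it\cdot x}\varphi(t)\,dt$. *)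

(* Defs.v *)
(* R^n is 'rV[R]_n and C is R[i], for an arbitrary R : realType. *)
From HB Require Import structures.
From mathcomp Require Import all_boot all_order all_algebra.
From mathcomp Require Import complex.
From mathcomp Require Import all_classical all_reals all_analysis.

Set Implicit Arguments.
Unset Strict Implicit.
Unset Printing Implicit Defensive.

Import Order.TTheory GRing.Theory Num.Theory.
Import numFieldNormedType.Exports.

Local Open Scope classical_set_scope.
Local Open Scope complex_scope.
Local Open Scope ring_scope.

Section measurable_rV.
Context {R : realType} (n : nat).

Definition rV_display : measure_display.
Proof. exact: default_measure_display. Qed.

(* The product sigma-algebra, generated by the coordinates; on 'rV[R]_n it is
   the Borel sigma-algebra. *)
Definition rV_coord (i : 'I_n) (v : 'rV[R]_n) : R := v ord0 i.
Definition rV_measurable : set (set 'rV[R]_n) := g_sigma_preimage rV_coord.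

Let rV_set0 : rV_measurable set0.
Proof. exact: sigma_algebra0. Qed.

Let rV_setC A : rV_measurable A -> rV_measurable (~` A).
Proof. exact: sigma_algebraC. Qed.

Let rV_bigcup (F : (set 'rV[R]_n)^nat) :
  (forall i, rV_measurable (F i)) -> rV_measurable (\bigcup_i F i).
Proof. exact: sigma_algebra_bigcup. Qed.

HB.instance Definition _ := @isMeasurable.Build rV_display 'rV[R]_n
  rV_measurable rV_set0 rV_setC rV_bigcup.

End measurable_rV.

Section measurable_fun_rV.
Context {R : realType}.

Lemma measurable_rV_coord n (i : 'I_n) :
  measurable_fun [set: 'rV[R]_n] (rV_coord i).
Proof.
move=> _ Y mY; rewrite setTI; apply: sub_sigma_algebra => /=.
rewrite -bigcup_seq/=; exists i => /=; first by rewrite mem_index_enum.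
by exists Y => //; rewrite setTI.
Qed.

Lemma measurable_fun_rVP d (T : measurableType d) n (f : T -> 'rV[R]_n) :
  (forall i, measurable_fun [set: T] (fun x => f x ord0 i)) ->
  measurable_fun [set: T] f.
Proof.
move=> mf.
have prefS : g_sigma_preimage (fun i => rV_coord i \o f) `<=` measurable.
  apply: smallest_sub; first exact: sigma_algebra_measurable.
  move=> A; rewrite -bigcup_seq/= => -[i _] [B mB <-]; exact: (mf i).
by move=> _ A mA; apply: prefS; rewrite g_sigma_preimage_comp; exists A.
Qed.

Definition rV_cons n (p : R * 'rV[R]_n) : 'rV[R]_n.+1 := row_mx p.1%:M p.2.

Lemma rV_cons0 n (p : R * 'rV[R]_n) : rV_cons p ord0 ord0 = p.1.
Proof.
rewrite /rV_cons (_ : ord0 = lshift n (ord0 : 'I_1)); last exact: val_inj.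
by rewrite (row_mxEl p.1%:M) mxE eqxx.
Qed.

Lemma rV_consS n (p : R * 'rV[R]_n) i :
  rV_cons p ord0 (lift ord0 i) = p.2 ord0 i.
Proof.
rewrite /rV_cons (_ : lift ord0 i = rshift 1 i); last exact: val_inj.
by rewrite (row_mxEr p.1%:M).
Qed.

Lemma measurable_rV_cons n :
  measurable_fun [set: measurableTypeR R * 'rV[R]_n] (@rV_cons n).
Proof.
apply: measurable_fun_rVP => i; have [j ->|->] := unliftP ord0 i.
- under eq_fun do rewrite rV_consS.
  apply: (measurableT_comp (measurable_rV_coord j)); exact: measurable_snd.
- under eq_fun do rewrite rV_cons0.
  exact: measurable_fst.
Qed.

Definition rV_uncons n (v : 'rV[R]_n.+1) : R * 'rV[R]_n :=
  (v ord0 ord0, \row_i v ord0 (lift ord0 i)).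

Lemma rV_consK n : cancel (@rV_cons n) (@rV_uncons n).
Proof.
move=> [x v]; rewrite /rV_uncons rV_cons0; congr pair.
by apply/rowP => i; rewrite mxE rV_consS.
Qed.

Lemma rV_unconsK n : cancel (@rV_uncons n) (@rV_cons n).
Proof.
move=> v; apply/rowP => i; have [j ->|->] := unliftP ord0 i.
- by rewrite rV_consS mxE.
- by rewrite rV_cons0.
Qed.

Lemma measurable_rV_uncons n :
  measurable_fun [set: 'rV[R]_n.+1]
    (@rV_uncons n : _ -> measurableTypeR R * 'rV[R]_n).
Proof.
apply: measurable_fun_pair; first exact: (measurable_rV_coord ord0).
apply: measurable_fun_rVP => i.
rewrite (_ : (fun _ => _) = rV_coord (lift ord0 i)).
  exact: measurable_rV_coord.
by apply/funext => v /=; rewrite mxE.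
Qed.

End measurable_fun_rV.

Section lebesgue_rV_succ.
Context {R : realType} (n : nat).
Variable mu : {sigma_finite_measure set 'rV[R]_n -> \bar R}.
Local Open Scope ereal_scope.

Definition lebesgue_rV_succ : set 'rV[R]_n.+1 -> \bar R :=
  pushforward (lebesgue_measure \x mu) (@rV_cons R n).

Let mcons : measurable_fun [set: measurableTypeR R * 'rV[R]_n] (@rV_cons R n).
Proof. exact: measurable_rV_cons. Qed.

Let succ0 : lebesgue_rV_succ set0 = 0.
Proof. by rewrite /lebesgue_rV_succ /pushforward preimage_set0 measure0. Qed.

Let succ_ge0 A : 0 <= lebesgue_rV_succ A.
Proof. exact: measure_ge0. Qed.

Let succ_sigma_additive : semi_sigma_additive lebesgue_rV_succ.
Proof. exact: measure_semi_sigma_additive. Qed.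

HB.instance Definition _ := isMeasure.Build _ _ _ lebesgue_rV_succ
  succ0 succ_ge0 succ_sigma_additive.

Let succ_sigma_finite : sigma_finite setT lebesgue_rV_succ.
Proof.
have /sigma_finiteP[F [TF ndF Foo]] := sigma_finiteT (@lebesgue_measure R).
have /sigma_finiteP[G [TG ndG Goo]] := sigma_finiteT mu.
exists (fun k => @rV_uncons R n @^-1` (F k `*` G k)).
  rewrite -preimage_bigcup; apply/esym/seteqP; split => // v _ /=.
  set p := rV_uncons v.
  have [i _ Fi] : (\bigcup_i F i) p.1 by rewrite -TF.
  have [j _ Gj] : (\bigcup_i G i) p.2 by rewrite -TG.
  exists (maxn i j) => //; split.
  - by move: Fi; exact/subsetPset/ndF/leq_maxl.
  - by move: Gj; exact/subsetPset/ndG/leq_maxr.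
move=> k; have [mF Fk] := Foo k; have [mG Gk] := Goo k; split.
  rewrite -[X in measurable X]setTI; apply: measurable_rV_uncons => //.
  exact: measurableX.
rewrite /lebesgue_rV_succ /pushforward -comp_preimage.
rewrite (_ : _ \o _ = id) ?preimage_id; last first.
  by apply/funext => x /=; rewrite rV_consK.
by rewrite product_measure1E// lte_mul_pinfty// ge0_fin_numE.
Qed.

HB.instance Definition _ := Measure_isSigmaFinite.Build _ _ _ lebesgue_rV_succ
  succ_sigma_finite.

End lebesgue_rV_succ.

Fixpoint lebesgue_rV {R : realType} (n : nat) :
    {sigma_finite_measure set 'rV[R]_n -> \bar R} :=
  match n with
  | 0%N => [the {sigma_finite_measure set _ -> \bar R} of
               dirac (0 : 'rV[R]_0)]
  | m.+1 => [the {sigma_finite_measure set _ -> \bar R} of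
               lebesgue_rV_succ (lebesgue_rV m)]
  end.

Lemma lebesgue_rV_box {R : realType} n (A : 'I_n -> set (measurableTypeR R)) :
  (forall i, measurable (A i)) ->
  lebesgue_rV n [set v : 'rV[R]_n | forall i, A i (v ord0 i)] =
  (\prod_(i < n) lebesgue_measure (A i))%E.
Proof.
elim: n A => [|n IH] A mA.
  by rewrite big_ord0 /= diracE mem_set//; case.
rewrite big_ord_recl -IH//= /lebesgue_rV_succ /pushforward.
rewrite -product_measure1E//; last first.
  rewrite (_ : [set v | _] = \bigcap_(i in [set: 'I_n])
      (@rV_coord R n i @^-1` A (lift ord0 i))).
    apply: fin_bigcap_measurable => // i _.
    rewrite -[X in measurable X]setTI.
    exact: (measurable_rV_coord i measurableT (mA (lift ord0 i))).
  apply/seteqP; split => [v Av i _|v Av i]; [exact: Av|exact: (Av i)].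
congr product_measure1; apply/seteqP; split => [[x v] Av|[x v] [Ax Av] i] /=.
- split=> [|i] /=; first by have := Av ord0; rewrite rV_cons0.
  by have := Av (lift ord0 i); rewrite rV_consS.
- by have [j ->|->] := unliftP ord0 i; rewrite ?rV_consS ?rV_cons0.
Qed.

Section euclidean.
Context {R : realType} {n : nat}.
Implicit Types (u v x : 'rV[R]_n) (A B K : set 'rV[R]_n).

Definition dotp u v : R := \sum_(i < n) u ord0 i * v ord0 i.

(* The library's norm on 'rV[R]_n is the sup norm. *)
Definition enorm u : R := Num.sqrt (dotp u u).

Definition eball (c : 'rV[R]_n) (r : R) : set 'rV[R]_n :=
  [set x | enorm (x - c) < r].

Definition scale_set (a : R) A : set 'rV[R]_n := [set a *: x | x in A].

Definition sum_set A B : set 'rV[R]_n := [set x + y | x in A & y in B].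

Definition convex_symmetric_body A : Prop :=
  [/\ compact A, convex_set A, A° !=set0 & A = [set - x | x in A]].

Definition polar K : set 'rV[R]_n := [set x | forall t, K t -> dotp x t <= 1].

Definition gauge_norm A x : R := inf [set a : R | 0 < a /\ scale_set a A x].

End euclidean.

Section bernstein.
Context {R : realType} {n : nat}.
Implicit Types (f phi : 'rV[R]_n -> R[i]) (K : set 'rV[R]_n).

Definition cintegral f : R[i] :=
  (\int[lebesgue_rV n]_x complex.Re (f x)) +i*
  (\int[lebesgue_rV n]_x complex.Im (f x)).

Definition expi (theta : R) : R[i] := cos theta +i* sin theta.

Definition fourier phi (x : 'rV[R]_n) : R[i] :=
  cintegral (fun t => expi (- dotp t x) * phi t).

Fixpoint Ck (k : nat) (g : 'rV[R]_n -> R) : Prop :=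
  continuous g /\
  if k is k'.+1 then
    forall j : 'I_n, (forall x, derivable g x (delta_mx ord0 j)) /\
                     Ck k' ('D_(delta_mx ord0 j) g)
  else True.

Definition smooth phi : Prop :=
  forall k, Ck k (fun x => complex.Re (phi x)) /\
            Ck k (fun x => complex.Im (phi x)).

Definition supp phi : set 'rV[R]_n := closure [set t | phi t != 0].

(* For f bounded and continuous and phi smooth with support in a ball, both
   integrals converge absolutely, so Rintegral never takes its default value.
   The balls are open and Euclidean. *)
Definition spectrum_in K f : Prop :=
  forall phi, smooth phi ->
    (exists c r,
      [/\ 0 < r, supp phi `<=` eball c r & eball c r `&` K = set0]) ->
    cintegral (fun x => f x * fourier phi x) = 0.

(* The codomain R[i]^o carries the topology of the complex modulus. *)
Definition bernstein K : set ('rV[R]_n -> R[i]) :=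
  [set f | [/\ continuous (f : 'rV[R]_n -> R[i]^o),
               exists M : R, forall x, `|f x| <= M%:C &
               spectrum_in K f]].

End bernstein.

(* Main.v *)
(* Let t1 maximise t . x0 over K: then t1 . x0 = pi / 2, and f x = cos (t1 . x)
   works with Lambda its zero set, because along every segment
   [x - x0, x + x0] the phase t1 . x moves by pi.

   That the spectrum of f is in {t1, -t1} is shown without Fourier inversion.
   Let phi be a test function supported in a ball with center c that does not
   contain t0 = t1 or t0 = - t1.  The integral of f times the transform of phi is
   a combination of integrals over x of
     osc a x = int_t cos ((t - t0) . x + const) a(t) dt,   a = Re phi or Im phi.
   The linear form s t = (t - t0) . (c - t0) is positive on the ball, so a / s is
   again a test function, and osc a is the derivative along c - t0 of a phase
   shifted osc (a / s).  Integrations by parts in t show that these functions of x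
   are O(prod_i 1 / (1 + x_i^2)); hence the integral over x of the derivative
   vanishes, by Fubini and the fundamental theorem of calculus. *)
Require Import Defs.
From mathcomp Require Import all_boot all_order all_algebra.
From mathcomp Require Import complex.
From mathcomp Require Import all_classical all_reals all_analysis.
From mathcomp Require Import measurable_realfun ring lra.

Set Implicit Arguments.
Unset Strict Implicit.
Unset Printing Implicit Defensive.

Import Order.TTheory GRing.Theory Num.Theory.
Import numFieldNormedType.Exports.

Local Open Scope classical_set_scope.
Local Open Scope complex_scope.
Local Open Scope ring_scope.

(** * Measurability in R^n: boxes, open sets, continuous functions *)

Lemma measurable_rV_box {R : realType} n (A : 'I_n -> set (measurableTypeR R)) :
  (forall i, measurable (A i)) ->
  measurable [set v : 'rV[R]_n | forall i, A i (v ord0 i)].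
Proof.
move=> mA; rewrite (_ : [set v | _] = \bigcap_(i in [set: 'I_n])
    (@rV_coord R n i @^-1` A i)); last first.
  by apply/seteqP; split => [v Av i _|v Av i]; [exact: Av|exact: (Av i)].
apply: fin_bigcap_measurable => // i _; rewrite -[X in measurable X]setTI.
exact: (measurable_rV_coord i measurableT (mA i)).
Qed.

(** Sup-norm balls are boxes, and an open set is the union of those with rational center and radius
    [k.+1%:R^-1] that it contains, a countable family. *)
Lemma open_measurable_rV {R : realType} n (U : set 'rV[R]_n) :
  open U -> measurable U.
Proof.
move=> oU.
pose q2R (q : 'rV[rat]_n) : 'rV[R]_n := map_mx ratr q.
pose B (p : 'rV[rat]_n * nat) : set 'rV[R]_n := ball (q2R p.1) p.2.+1%:R^-1.
have -> : U = \bigcup_(p in [set p | B p `<=` U]) B p.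
  apply/seteqP; split => [x Ux|x [p pU Bx]]; last exact: pU.
  have [e /= e0 xeU] : nbhs_ball x U.
    by rewrite nbhs_ballE; exact: open_nbhs_nbhs.
  (* The factor 2 pays for moving the center from [x] to a rational point at distance less than
     [k.+1%:R^-1]. *)
  have [k ke] : exists k, 2 * k.+1%:R^-1 < e.
    have [k _ kh] := near_infty_natSinv_lt (PosNum (divr_gt0 e0 (ltr0n R 2))).
    exists k; have := kh k (leqnn _) => /=.
    by rewrite ltr_pdivlMr// mulrC.
  have k0 : 0 < k.+1%:R^-1 :> R by rewrite invr_gt0.
  have /choice[q qP] : forall i, exists r : rat,
      ball (x ord0 i) k.+1%:R^-1 (ratr r : R).
    move=> i; have [//||y [xy [r _ ry]]] :=
      @dense_rat R (ball (x ord0 i) k.+1%:R^-1).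
    - by exists (x ord0 i); exact: ballxx.
    - exact: ball_open.
    - by exists r; rewrite ry.
  have Bxq : ball x k.+1%:R^-1 (q2R (\row_i q i)).
    by split => // i j; rewrite !ord1 !mxE; exact: qP.
  exists (\row_i q i, k); last exact/ball_sym.
  move=> y By; apply: xeU; apply: le_ball (ltW ke) _ _.
  by rewrite mulr_natl mulr2n; exact: ball_triangle Bxq By.
(* Balls not contained in [U] are replaced by the empty set, so that the union runs over a whole
   countable type. *)
rewrite bigcup_mkcond; apply: countable_bigcupT_measurable => // -[q k].
case: ifPn => // _; rewrite /B/=.
rewrite (_ : ball _ _ = [set v : 'rV[R]_n | forall i,
    (ball (q2R q ord0 i) k.+1%:R^-1 : set (measurableTypeR R)) (v ord0 i)]).
  apply: (@measurable_rV_box _ _ (fun i => ball (q2R q ord0 i) _)) => i.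
  exact: measurable_ball.
apply/seteqP; split => [v [_ qv] i|v qv]; first exact: qv.
by split; [rewrite invr_gt0|move=> i j; rewrite !ord1; exact: qv].
Qed.

Lemma continuous_measurable_rV {R : realType} n (f : 'rV[R]_n -> R) :
  continuous f -> measurable_fun [set: 'rV[R]_n] f.
Proof.
move=> cf; apply: (measurability _ (RGenOpens.measurableE R)).
move=> _ [_ [a [b ->] <-]]; rewrite setTI; apply: open_measurable_rV.
by move/continuousP : cf; apply; exact: interval_open.
Qed.

(** * Integrable majorants and decaying functions *)

(** The function is even, and its integral over the half line is finite. *)
Lemma integrable_oneDsqrV {R : realType} :
  (@lebesgue_measure R).-integrable setT (EFin \o (fun x => (oneDsqr x)^-1)).
Proof.
have ge0 (x : R) : 0 <= (oneDsqr x)^-1.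
  by rewrite invr_ge0 (le_trans _ (oneDsqr_ge1 _)).
apply/integrableP; split.
  apply/measurable_EFinP; apply: continuous_measurable_fun.
  exact: continuous_oneDsqrV.
under eq_integral do rewrite /= ger0_norm ?ge0//.
rewrite (@ge0_symfun_integralT R (fun x => (oneDsqr x)^-1))//.
- rewrite (_ : [set x | _] = `[0, +oo[%classic).
    by rewrite integral0y_oneDsqr -EFinM ltry.
  by apply/seteqP; split => x; rewrite /= in_itv/= andbT.
- exact: continuous_oneDsqrV.
- by move=> x /=; rewrite /oneDsqr sqrrN.
Qed.

Section decay.
Context {R : realType}.

(** An integrable majorant that factors over the coordinates, so that domination survives freezing
    some of them; [oneDsqr y] is 1 + y^2. *)
Definition weight n (x : 'rV[R]_n) : R := \prod_(i < n) (oneDsqr (x ord0 i))^-1.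

Definition decaying n (f : 'rV[R]_n -> R) :=
  exists C, forall x, `|f x| <= C * weight x.

Lemma weight_rV_cons n (p : R * 'rV[R]_n) :
  weight (rV_cons p) = (oneDsqr p.1)^-1 * weight p.2.
Proof.
rewrite /weight big_ord_recl rV_cons0; congr (_ * _).
by apply: eq_bigr => i _; rewrite rV_consS.
Qed.

Lemma weight_gt0 n (x : 'rV[R]_n) : 0 < weight x.
Proof.
by apply: prodr_gt0 => i _; rewrite invr_gt0 (lt_le_trans ltr01 (oneDsqr_ge1 _)).
Qed.

Lemma measurable_weight n : measurable_fun setT (@weight n).
Proof.
apply: measurable_prod => i _.
have moneV : measurable_fun setT (fun y : R => (oneDsqr y)^-1).
  by apply: continuous_measurable_fun; exact: continuous_oneDsqrV.
exact: (measurableT_comp moneV (measurable_rV_coord i)).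
Qed.

Lemma measurable_EFin_weight n : measurable_fun setT (EFin \o @weight n).
Proof. by apply/measurable_EFinP; exact: measurable_weight. Qed.

Lemma integrable_rV_succ n (f : 'rV[R]_n.+1 -> \bar R) :
  measurable_fun setT f ->
  (lebesgue_measure \x lebesgue_rV n)%E.-integrable setT (f \o @rV_cons R n) ->
  (lebesgue_rV n.+1).-integrable setT f.
Proof.
by move=> mf intf; apply: integrable_pushforward => //; exact: measurable_rV_cons.
Qed.

Lemma integral_rV_succ n (f : 'rV[R]_n.+1 -> \bar R) :
  measurable_fun setT f ->
  (lebesgue_measure \x lebesgue_rV n)%E.-integrable setT (f \o @rV_cons R n) ->
  (\int[lebesgue_rV n.+1]_x f x =
   \int[lebesgue_measure \x lebesgue_rV n]_p f (rV_cons p))%E.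
Proof.
by move=> mf intf; rewrite integral_pushforward//; exact: measurable_rV_cons.
Qed.

(** By Tonelli, the double integral of [|f| |g|] is a product of two finite integrals. *)
Lemma integrable_mul_prod d1 d2 (T1 : measurableType d1) (T2 : measurableType d2)
    (m1 : {sigma_finite_measure set T1 -> \bar R})
    (m2 : {sigma_finite_measure set T2 -> \bar R}) (f : T1 -> R) (g : T2 -> R) :
  m1.-integrable setT (EFin \o f) -> m2.-integrable setT (EFin \o g) ->
  (m1 \x m2)%E.-integrable setT (EFin \o (fun p => f p.1 * g p.2)).
Proof.
move=> intf intg; have := intf; have := intg.
move=> /integrableP[/measurable_EFinP mg oog] /integrableP[/measurable_EFinP mf oof].
apply/integrable12ltyP.
  apply/measurable_EFinP; apply: measurable_funM.
    exact: (measurableT_comp mf measurable_fst).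
  exact: (measurableT_comp mg measurable_snd).
under eq_integral => x _.
  under eq_integral do rewrite /= normrM EFinM.
  rewrite ge0_integralZl//; last first.
    by apply/measurable_EFinP; exact: measurableT_comp.
  over.
rewrite ge0_integralZr//.
- apply: lte_mul_pinfty => //; first exact: integral_ge0.
  by rewrite ge0_fin_numE//; exact: integral_ge0.
- by apply/measurable_EFinP; exact: measurableT_comp.
- exact: integral_ge0.
Qed.

Lemma integrable_weight n : (lebesgue_rV n).-integrable setT (EFin \o @weight n).
Proof.
elim: n => [|n IH].
  apply/integrableP; split; first exact: measurable_EFin_weight.
  rewrite integral_dirac//; last first.
    by apply: measurableT_comp => //; exact: measurable_EFin_weight.
  by rewrite diracT mul1e ltry.
apply: integrable_rV_succ; first exact: measurable_EFin_weight.
rewrite (_ : _ \o _ = EFin \o (fun p : measurableTypeR R * 'rV[R]_n =>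
    (oneDsqr p.1)^-1 * weight p.2)).
  exact: (integrable_mul_prod integrable_oneDsqrV IH).
by apply/funext => p /=; rewrite weight_rV_cons.
Qed.

Lemma decaying_integrable n (f : 'rV[R]_n -> R) :
  measurable_fun setT f -> decaying f ->
  (lebesgue_rV n).-integrable setT (EFin \o f).
Proof.
move=> mf [C fC]; apply: (@le_integrable _ _ _ _ setT measurableT _
    (fun x => (C * weight x)%:E)) => //.
- exact/measurable_EFinP.
- by move=> x _; rewrite lee_fin (le_trans (fC x))// ler_norm.
- exact: (integrableZl measurableT C (integrable_weight n)).
Qed.

(** The same domination, read on the product of the first coordinate with the others, which is the
    form that Fubini takes as input. *)
Lemma decaying_integrable_prod n (f : 'rV[R]_n.+1 -> R) :
  measurable_fun setT f -> decaying f ->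
  (lebesgue_measure \x lebesgue_rV n)%E.-integrable setT
    (EFin \o f \o @rV_cons R n).
Proof.
move=> mf [C fC]; apply: (@le_integrable _ _ _ _ setT measurableT _
    (fun p : measurableTypeR R * 'rV[R]_n =>
      (C * ((oneDsqr p.1)^-1 * weight p.2))%:E)) => //.
- apply/measurable_EFinP; apply: measurableT_comp mf _.
  exact: measurable_rV_cons.
- move=> p _; rewrite lee_fin (le_trans (fC _))// weight_rV_cons.
  exact: ler_norm.
- have intw := integrable_mul_prod integrable_oneDsqrV (integrable_weight n).
  exact: (integrableZl measurableT C intw).
Qed.

End decay.

(** * Vanishing integrals of derivatives *)

(** The fundamental theorem turns the integral of [g'] over [-(k+1), k+1] into a difference of
    boundary values of [g], which tend to 0; dominated convergence identifies the limit with the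
    full integral. *)
Lemma integral_derive_oneDsqr {R : realType} (g g' : R -> R) (C C' : R) :
  (forall x : R, is_derive x 1 g (g' x)) -> continuous g' ->
  (forall x, `|g' x| <= C / oneDsqr x) -> (forall x, `|g x| <= C' / oneDsqr x) ->
  (\int[@lebesgue_measure R]_x (g' x)%:E = 0)%E.
Proof.
move=> dg cg' g'C gC.
have mg' : measurable_fun setT g' by exact: continuous_measurable_fun.
(* With [k.+1] the interval is nondegenerate already for k = 0, as [continuous_FTC2] requires. *)
pose I k := `[- k.+1%:R, k.+1%:R : R]%classic.
have intC : (@lebesgue_measure R).-integrable setT
    (fun x : measurableTypeR R => (C / oneDsqr x)%:E).
  exact: (integrableZl measurableT C integrable_oneDsqrV).
have [|||||_ _ cvg_int] := @dominated_convergence _ (measurableTypeR R) R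
    lebesgue_measure setT measurableT (fun k => (EFin \o g') \_ (I k))
    (EFin \o g') (fun x : measurableTypeR R => (C / oneDsqr x)%:E).
- move=> k; apply/(measurable_restrictT _ _).1; first exact: measurable_itv.
  by apply/measurable_EFinP; exact: measurable_funTS.
- exact/measurable_EFinP.
- apply/aeW => x _; apply: cvg_near_cst; near=> k; rewrite patchT// inE /I/=.
  rewrite in_itv/= -ler_norml; near: k.
  exists (Num.truncn `|x|).+1 => // k /= xk.
  have := truncnS_gt `|x|; move/ltW/le_trans; apply.
  by rewrite ler_nat (leq_trans xk).
- exact: intC.
- apply/aeW => x k _; rewrite /patch; case: ifPn => _.
    by rewrite lee_fin g'C.
  by rewrite abse0 lee_fin (le_trans _ (g'C x)).
have intE k : (\int[lebesgue_measure]_x ((EFin \o g') \_ (I k)) x =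
    (g k.+1%:R - g (- k.+1%:R))%:E)%E.
  have cg : continuous g.
    move=> x; apply/differentiable_continuous/derivable1_diffP.
    by have [] := dg x.
  rewrite -integral_mkcond (continuous_FTC2 (F := g))//.
  - by rewrite gtrN.
  - exact: continuous_subspaceT.
  - split.
    + by move=> x _; have [] := dg x.
    + exact/cvg_at_right_filter/cg.
    + exact/cvg_at_left_filter/cg.
  - by move=> x _; rewrite derive1E; have [] := dg x.
have C'0 : 0 <= C'.
  rewrite (le_trans (normr_ge0 (g 0)))// (le_trans (gC 0))//.
  by rewrite /oneDsqr expr0n/= addr0 divr1.
have cvg0 : ((\int[lebesgue_measure]_x ((EFin \o g') \_ (I k)) x)%E
    @[k --> \oo] --> 0%:E).
  under eq_fun do rewrite intE; apply: cvg_EFin; first exact: nearW.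
  apply: norm_cvg0.
  apply: (@squeeze_cvgr _ _ _ _ (cst 0) (fun k => (C' *+ 2) * harmonic k)).
  - apply/nearW => k; rewrite normr_ge0/=.
    (* Since 1 + (k+1)^2 >= k+1, each boundary value is at most C' / (k+1). *)
    have gk y : `|y| = k.+1%:R -> `|g y| <= C' * harmonic k.
      move=> yk; rewrite (le_trans (gC y))// ler_wpM2l// lef_pV2 ?posrE//.
      rewrite /oneDsqr -real_normK ?num_real// yk.
      by have := ler0n R k.+1; nra.
    rewrite (le_trans (ler_normB _ _))// mulrnAl mulr2n lerD// gk// ?normrN//;
      by rewrite ger0_norm.
  - exact: cvg_cst.
  - by rewrite -[X in _ --> X](mulr0 (C' *+ 2)); apply: cvgMr; exact: cvg_harmonic.
exact: (cvg_unique (@ereal_hausdorff R) cvg_int cvg0).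
Unshelve. all: by end_near. Qed.

Lemma continuous_rV {R : realType} (T : topologicalType) n (f : T -> 'rV[R]_n) :
  (forall i, continuous (fun t => f t ord0 i)) -> continuous f.
Proof.
move=> cf t; apply/cvg_ballP => e e0; near=> s.
split => // i j; rewrite ord1; move: j; near: s.
apply: filter_forall => j; move/cvg_ballP : (cf j t); exact.
Unshelve. all: by end_near. Qed.

Section derive_along.
Context {R : realType} {U V W : normedModType R}.
Variables (g : V -> W) (a : U -> V) (u e : U) (e' : V).
Hypothesis ae : forall h, a (h *: e + u) = h *: e' + a u.

(** As [a] is affine along [e], both difference quotients are the same function of [h]. This serves
    as chain rule for coordinate slices and for phases alike. *)
Let quotientE :
  (fun h : R => h^-1 *: (((g \o a) \o shift u) (h *: e) - (g \o a) u)) =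
  (fun h : R => h^-1 *: ((g \o shift (a u)) (h *: e') - g (a u))).
Proof. by apply/funext => h /=; rewrite ae. Qed.

Lemma derivable_along : derivable (g \o a) u e = derivable g (a u) e'.
Proof. by rewrite /derivable quotientE. Qed.

Lemma derive_along : 'D_e (g \o a) u = 'D_e' g (a u).
Proof. by rewrite /derive quotientE. Qed.

End derive_along.

Section integral_derive.
Context {R : realType}.

Lemma rV_cons_addZ0 n (h x : R) (v : 'rV[R]_n) :
  rV_cons (h + x, v) = h *: delta_mx ord0 ord0 + rV_cons (x, v).
Proof.
apply/rowP => i; rewrite [RHS]mxE [X in _ = X + _]mxE [X in _ * X]mxE/=.
have [j ->|->] := unliftP ord0 i.
- by rewrite !rV_consS eq_sym (negbTE (neq_lift _ _)) mulr0 add0r.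
- by rewrite !rV_cons0 mulr1.
Qed.

Lemma rV_cons_addZS n (h x : R) (v : 'rV[R]_n) j :
  rV_cons (x, h *: delta_mx ord0 j + v) =
  h *: delta_mx ord0 (lift ord0 j) + rV_cons (x, v).
Proof.
apply/rowP => i; rewrite [RHS]mxE [X in _ = X + _]mxE [X in _ * X]mxE/=.
have [k ->|->] := unliftP ord0 i.
- by rewrite !rV_consS !mxE/= (inj_eq lift_inj).
- by rewrite !rV_cons0 (negbTE (neq_lift _ _)) mulr0 add0r.
Qed.

Lemma continuous_rV_cons1 n (v : 'rV[R]_n) : continuous (fun x => rV_cons (x, v)).
Proof.
apply: continuous_rV => i; have [j ->|->] := unliftP ord0 i.
- by under eq_fun do rewrite rV_consS; exact: cst_continuous.
- by under eq_fun do rewrite rV_cons0.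
Qed.

Lemma continuous_rV_cons2 n (x : R) :
  continuous (fun v : 'rV[R]_n => rV_cons (x, v)).
Proof.
apply: continuous_rV => i; have [j ->|->] := unliftP ord0 i.
- by under eq_fun do rewrite rV_consS; exact: coord_continuous.
- by under eq_fun do rewrite rV_cons0; exact: cst_continuous.
Qed.

(** Induction on the dimension with Fubini. If [j] is the first coordinate, the inner integral is
    over it and vanishes by the one-variable case; otherwise the first coordinate is frozen and the
    induction hypothesis applies to the slice. *)
Lemma integral_derive n (g : 'rV[R]_n -> R) (j : 'I_n) :
  (forall x, derivable g x (delta_mx ord0 j)) ->
  continuous ('D_(delta_mx ord0 j) g) ->
  decaying g -> decaying ('D_(delta_mx ord0 j) g) ->
  (\int[lebesgue_rV n]_x ('D_(delta_mx ord0 j) g x)%:E = 0)%E.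
Proof.
elim: n g j => [|n IH] g j; first by case: j.
set e := delta_mx ord0 j => dg cg' [C gC] [C' g'C].
have mg' : measurable_fun setT ('D_e g) by exact: continuous_measurable_rV.
have intg' : (lebesgue_measure \x lebesgue_rV n)%E.-integrable setT
    (EFin \o 'D_e g \o @rV_cons R n).
  by apply: decaying_integrable_prod => //; exists C'.
rewrite integral_rV_succ//; last exact/measurable_EFinP.
have [i ji|j0] := unliftP ord0 j.
- rewrite -(integral12_prod_meas1 intg').
  rewrite integral0_eq// => x _; rewrite /fubini_F/=.
  pose gx v := g (rV_cons (x, v)).
  have dE v : 'D_(delta_mx ord0 i) gx v = 'D_e g (rV_cons (x, v)).
    apply: (@derive_along _ _ _ _ g (fun v => rV_cons (x, v))) => h.
    by rewrite rV_cons_addZS /e ji.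
  under eq_integral do rewrite -dE.
  apply: IH.
  + move=> v; rewrite (@derivable_along _ _ _ _ g (fun v => rV_cons (x, v)) _ _ e)//.
    by move=> h; rewrite rV_cons_addZS /e ji.
  + rewrite (funext dE) => v.
    exact: (continuous_comp (@continuous_rV_cons2 n x v) (cg' _)).
  + exists (C / oneDsqr x) => v.
    by rewrite (le_trans (gC _))// weight_rV_cons mulrA.
  + exists (C' / oneDsqr x) => v.
    by rewrite dE (le_trans (g'C _))// weight_rV_cons mulrA.
- rewrite -(integral21_prod_meas1 intg').
  rewrite integral0_eq// => v _; rewrite /fubini_G/=.
  have consE (x h : R) :
      rV_cons (h *: (1 : R) + x, v) = h *: e + rV_cons (x, v).
    by rewrite /e j0 -rV_cons_addZ0 /GRing.scale/= mulr1.
  apply: (@integral_derive_oneDsqr R (fun x => g (rV_cons (x, v))) _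
    (C' * weight v) (C * weight v)).
  + move=> x; split.
      by rewrite (@derivable_along _ _ _ _ g (fun x => rV_cons (x, v)) _ _ e (consE x)).
    by rewrite (@derive_along _ _ _ _ g (fun x => rV_cons (x, v)) _ _ e (consE x)).
  + move=> x; exact: (continuous_comp (@continuous_rV_cons1 n v x) (cg' _)).
  + by move=> x; rewrite (le_trans (g'C _))// weight_rV_cons/= mulrAC mulrA.
  + by move=> x; rewrite (le_trans (gC _))// weight_rV_cons/= mulrAC mulrA.
Qed.

End integral_derive.

(** * Differentiation rules and functions of class C^k *)

Section is_derive_fun.
Context {R : realType} {V : normedModType R}.
Implicit Types (f g : V -> R) (x v : V).

Lemma is_derive_addf f g x v df dg :
  is_derive x v f df -> is_derive x v g dg ->
  is_derive x v (fun y => f y + g y) (df + dg).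
Proof. by move=> f' g'; exact: is_deriveD. Qed.

Lemma is_derive_mulf f g x v df dg :
  is_derive x v f df -> is_derive x v g dg ->
  is_derive x v (fun y => f y * g y) (df * g x + f x * dg).
Proof.
move=> f' g'; apply: (@is_derive_eq _ _ _ (f * g)).
by rewrite addrC /GRing.scale/= [g x * _]mulrC.
Qed.

Lemma is_derive_invf f x v df : f x != 0 ->
  is_derive x v f df -> is_derive x v (fun y => (f y)^-1) (- (f x) ^- 2 * df).
Proof.
move=> fx0 [f' <-]; split; first exact: derivableV.
by rewrite (deriveV fx0 f').
Qed.

End is_derive_fun.

Section Ck_theory.
Context {R : realType} {n : nat}.
Implicit Types f g h s : 'rV[R]_n -> R.

Lemma continuous_Df (T : topologicalType) (f g : T -> R) :
  continuous f -> continuous g -> continuous (fun x => f x + g x).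
Proof. by move=> cf cg x; exact: (cvgD (cf x) (cg x)). Qed.

Lemma continuous_Mf (T : topologicalType) (f g : T -> R) :
  continuous f -> continuous g -> continuous (fun x => f x * g x).
Proof. by move=> cf cg x; exact: (cvgM (cf x) (cg x)). Qed.

(** Lets explicit formulas [df] replace the operator ['D] in which the recursion of [Ck] is
    phrased. *)
Lemma Ck_intro k f (df : 'I_n -> 'rV[R]_n -> R) : continuous f ->
  (forall j x, is_derive x (delta_mx ord0 j) f (df j x)) ->
  (forall j, Ck k (df j)) -> Ck k.+1 f.
Proof.
move=> cf f' Cdf; split => // j; split; first by move=> x; have [] := f' j x.
rewrite (_ : 'D_(delta_mx ord0 j) f = df j)//.
by apply/funext => x; have [_ ->] := f' j x.
Qed.

Lemma Ck_is_derive k f : Ck k.+1 f ->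
  forall j x, is_derive x (delta_mx ord0 j) f ('D_(delta_mx ord0 j) f x).
Proof. by move=> [_ f'] j x; apply: derivableP; have [] := f' j. Qed.

Lemma Ck_derive k f : Ck k.+1 f -> forall j, Ck k ('D_(delta_mx ord0 j) f).
Proof. by move=> [_ f'] j; have [] := f' j. Qed.

Lemma Ck_continuous k f : Ck k f -> continuous f.
Proof. by case: k => [|k] []. Qed.

Lemma CkW k f : Ck k.+1 f -> Ck k f.
Proof.
elim: k f => [|k IH] f Cf; first by split => //; exact: Ck_continuous Cf.
apply: (Ck_intro (Ck_continuous Cf) (Ck_is_derive Cf)) => j.
exact/IH/Ck_derive.
Qed.

Lemma Ck_cst k (c : R) : Ck k (fun _ : 'rV[R]_n => c).
Proof.
elim: k c => [|k IH] c; first by split => //; exact: cst_continuous.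
apply: (@Ck_intro _ _ (fun _ _ => 0)) => //; first exact: cst_continuous.
Qed.

Lemma CkD k f g : Ck k f -> Ck k g -> Ck k (fun x => f x + g x).
Proof.
elim: k f g => [|k IH] f g Cf Cg.
  split => //.
  exact: continuous_Df (Ck_continuous Cf) (Ck_continuous Cg).
apply: (Ck_intro (df := fun j x => _)).
- exact: continuous_Df (Ck_continuous Cf) (Ck_continuous Cg).
- move=> j x.
  by apply: is_derive_addf; [exact: (Ck_is_derive Cf)|exact: (Ck_is_derive Cg)].
- by move=> j; apply: IH; exact: Ck_derive.
Qed.

Lemma CkM k f g : Ck k f -> Ck k g -> Ck k (fun x => f x * g x).
Proof.
elim: k f g => [|k IH] f g Cf Cg.
  split => //.
  exact: continuous_Mf (Ck_continuous Cf) (Ck_continuous Cg).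
apply: (Ck_intro (df := fun j x => _)).
- exact: continuous_Mf (Ck_continuous Cf) (Ck_continuous Cg).
- move=> j x.
  by apply: is_derive_mulf; [exact: (Ck_is_derive Cf)|exact: (Ck_is_derive Cg)].
- move=> j; apply: CkD; apply: IH; by [exact: CkW|exact: Ck_derive].
Qed.

Lemma is_derive_coord (i j : 'I_n) (x : 'rV[R]_n) :
  is_derive x (delta_mx ord0 j) (fun y : 'rV[R]_n => y ord0 i) (i == j)%:R.
Proof.
have lin : forall h : R, (h *: delta_mx ord0 j + x) ord0 i =
    h *: ((i == j)%:R : R) + x ord0 i.
  by move=> h; rewrite !mxE.
split.
  have := @derivable_along _ _ _ _ id (fun y : 'rV[R]_n => y ord0 i) _ _ _ lin.
  by move=> ->; exact: derivable_id.
have := @derive_along _ _ _ _ id (fun y : 'rV[R]_n => y ord0 i) _ _ _ lin.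
by move=> ->; rewrite derive_id.
Qed.

Lemma Ck_coord k (i : 'I_n) : Ck k (fun x : 'rV[R]_n => x ord0 i).
Proof.
case: k => [|k]; first by split => //; exact: coord_continuous.
apply: (Ck_intro _ (fun j x => is_derive_coord i j x)).
  exact: coord_continuous.
by move=> j; exact: Ck_cst.
Qed.

Lemma Ck_sum k (I : Type) (r : seq I) (F : I -> 'rV[R]_n -> R) :
  (forall i, Ck k (F i)) -> Ck k (fun x => \sum_(i <- r) F i x).
Proof.
move=> CF; elim: r => [|i r IH].
  by under eq_fun do rewrite big_nil; exact: Ck_cst.
by under eq_fun do rewrite big_cons; exact: CkD.
Qed.

(* [h / s] is extended by [0] across the zeros of [s], near which [h] vanishes. *)
Lemma continuous_div_vanishing s h : continuous s -> continuous h ->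
  (forall x, s x = 0 -> \forall y \near x, h y = 0) ->
  continuous (fun x => h x / s x).
Proof.
move=> cs ch h0 x; have [sx0|sx0] := eqVneq (s x) 0.
  have e0 : {near x, (fun=> 0) =1 (fun y => h y / s y)}.
    by apply: filterS (h0 x sx0) => y ->; rewrite mul0r.
  apply: cvg_trans (near_eq_cvg e0) _.
  by rewrite /= sx0 invr0 mulr0; exact: cvg_cst.
exact: (cvgM (ch x) (cvgV sx0 (cs x))).
Qed.

(** The derivative is written h'/s - s' ((h/s)/s): every quotient in it has denominator [s] and a
    numerator that vanishes near the zeros of [s], so an induction on [k] for all [h] closes. *)
Lemma Ck_div k s h : (forall k', Ck k' s) ->
  (forall x, s x = 0 -> \forall y \near x, h y = 0) -> Ck k h ->
  Ck k (fun x => h x / s x).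
Proof.
move=> Cs; have cs := Ck_continuous (Cs 0%N).
elim: k h => [|k IH] h h0 Ch; have ch := Ck_continuous Ch.
  by split => //; exact: continuous_div_vanishing.
have h'0 j x : s x = 0 -> \forall y \near x, 'D_(delta_mx ord0 j) h y = 0.
  move=> /h0 /nbhs_interior; apply: filterS => y hy.
  rewrite (@near_eq_derive _ _ _ _ (cst 0)) ?derive_cst//.
have hs0 x : s x = 0 -> \forall y \near x, h y / s y = 0.
  by move=> /h0; apply: filterS => y ->; rewrite mul0r.
apply: (@Ck_intro _ _ (fun j x => 'D_(delta_mx ord0 j) h x / s x -
    'D_(delta_mx ord0 j) s x * ((h x / s x) / s x))).
- exact: continuous_div_vanishing.
- move=> j x; have [sx0|sx0] := eqVneq (s x) 0.
    (* With the convention 0^-1 = 0 the formula gives 0 here, which is the derivative of a quotient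
       that is 0 near [x]. *)
    rewrite sx0 invr0 !mulr0 subr0.
    apply: (@near_eq_is_derive _ _ _ (cst 0)).
    by apply: filterS (hs0 x sx0) => y ->.
  apply: is_derive_eq.
    apply: is_derive_mulf; first exact: (Ck_is_derive Ch).
    by apply: is_derive_invf => //; exact: (Ck_is_derive (Cs 1%N)).
  rewrite expr2 invfM; ring.
- move=> j; apply: CkD; first by apply: IH; [exact: h'0|exact: Ck_derive].
  under eq_fun do rewrite -mulNr; apply: CkM.
    under eq_fun do rewrite -mulN1r.
    by apply: CkM; [exact: Ck_cst|exact: Ck_derive].
  (* The induction hypothesis is used twice: for h/s, then for (h/s)/s. *)
  by apply: IH hs0 (IH _ h0 (CkW Ch)).
Qed.

End Ck_theory.

(** * Smooth functions of bounded support *)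

Section bounded_support.
Context {R : realType} {n : nat}.
Implicit Types a b f s : 'rV[R]_n -> R.

Definition bounded_support a := exists M, forall x, M < `|x| -> a x = 0.

Definition test_fun a := (forall k, Ck k a) /\ bounded_support a.

(** On the compact ball of radius [M] the function is bounded, and the weight is bounded below
    there. *)
Lemma bounded_support_decaying a :
  continuous a -> bounded_support a -> decaying a.
Proof.
move=> ca [M aM].
have [A aA] : exists A, forall x, `|a x| <= A.
  have cK : compact [set x : 'rV[R]_n | `|x| <= M].
    apply: bounded_closed_compact.
      exists M; split; first exact: num_real.
      by move=> y My x /= xM; rewrite (le_trans xM)// ltW.
    rewrite (_ : [set x | _] = (@Num.norm R 'rV[R]_n) @^-1` [set y : R | y <= M])//.
    by apply: closed_comp => [x _|]; [exact: norm_continuous|exact: closed_le].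
  have [K0|K0] := pselect ([set x : 'rV[R]_n | `|x| <= M] !=set0).
    have [|c _ cmax] := @compact_EVT_max _ _ (fun x => `|a x|) _ K0 cK.
      apply: continuous_subspaceT => x.
      by apply: (continuous_comp (ca x)); exact: norm_continuous.
    exists `|a c| => x; have [xM|xM] := leP `|x| M; first by rewrite cmax// inE.
    by rewrite aM// normr0.
  (* Here [M] is negative, the ball is empty and [a] vanishes identically. *)
  exists 0 => x; rewrite aM ?normr0// ltNge; apply/negP => xM.
  by apply: K0; exists x.
(* Each of the [n] factors 1 + x_i^2 is at most 1 + M^2 on the ball. *)
exists (A * (1 + M ^+ 2) ^+ n) => x; have [xM|xM] := leP `|x| M; last first.
  rewrite aM// normr0 mulr_ge0 ?(ltW (weight_gt0 _))// mulr_ge0//.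
    by rewrite (le_trans _ (aA 0)).
  by rewrite exprn_ge0// addr_ge0// sqr_ge0.
rewrite -mulrA (le_trans (aA x))// ler_peMr//; first by rewrite (le_trans _ (aA 0)).
rewrite /weight prodfV ler_pdivlMr; last first.
  by apply: prodr_gt0 => i _; rewrite (lt_le_trans ltr01 (oneDsqr_ge1 _)).
rewrite mul1r [leRHS](_ : _ = \prod_(i < n) (1 + M ^+ 2)); last first.
  by rewrite prodr_const card_ord.
apply: ler_prod => i _; rewrite (le_trans ler01 (oneDsqr_ge1 _))/=.
rewrite lerD2l -real_normK ?num_real// lerXn2r ?nnegrE//.
  by rewrite (le_trans _ xM).
apply: le_trans xM; rewrite [leRHS]/Num.norm/= mx_normrE.
exact: (@le_bigmax _ _ _ 0 (fun ij => `|x ij.1 ij.2|) (ord0, i)).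
Qed.

(** The condition [M < |x|] is open, so [a] is 0 near such a point and its derivative is 0 at it. *)
Lemma test_fun_derive a j : test_fun a -> test_fun ('D_(delta_mx ord0 j) a).
Proof.
move=> [Ca [M aM]]; split=> [k|]; first exact: Ck_derive (Ca k.+1) j.
exists M => x Mx; rewrite (@near_eq_derive _ _ _ _ (cst 0)) ?derive_cst//.
have : \forall y \near x, M < `|y : 'rV[R]_n|.
  apply/nbhs_ballP; exists (`|x| - M); rewrite /= ?subr_gt0// => y.
  rewrite -ball_normE/= => xy; have := ler_normD (x - y) y.
  rewrite subrK => xyy; move: (`|x|) (`|y|) (`|x - y|) xyy xy => a1 a2 a3; lra.
by apply: filterS => y /aM.
Qed.

Lemma test_funM f a : (forall k, Ck k f) -> test_fun a ->
  test_fun (fun x => f x * a x).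
Proof.
move=> Cf [Ca [M aM]]; split=> [k|]; first exact: CkM.
by exists M => x /aM ->; rewrite mulr0.
Qed.

Lemma test_funD a b : test_fun a -> test_fun b -> test_fun (fun x => a x + b x).
Proof.
move=> [Ca [M aM]] [Cb [N bN]]; split=> [k|]; first exact: CkD.
exists (Num.max M N) => x; rewrite gt_max => /andP[/aM -> /bN ->].
by rewrite addr0.
Qed.

Lemma test_funB a b : test_fun a -> test_fun b -> test_fun (fun x => a x - b x).
Proof.
move=> ta tb; under eq_fun do rewrite -mulN1r; apply: test_funD => //.
by apply: test_funM => // k; exact: Ck_cst.
Qed.

Lemma test_fun_div s a : (forall k, Ck k s) ->
  (forall x, s x = 0 -> \forall y \near x, a y = 0) -> test_fun a ->
  test_fun (fun x => a x / s x).
Proof.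
move=> Cs a0 [Ca [M aM]]; split=> [k|]; first exact: Ck_div.
by exists M => x /aM ->; rewrite mul0r.
Qed.

Lemma test_fun_continuous a : test_fun a -> continuous a.
Proof. by move=> [Ca _]; exact: Ck_continuous (Ca 0%N). Qed.

Lemma test_fun_decaying a : test_fun a -> decaying a.
Proof.
by move=> ta; apply: bounded_support_decaying;
  [exact: test_fun_continuous|case: ta].
Qed.

End bounded_support.

(** * Chain rules along a line, and the dot product *)

Lemma is_derive_along {R : realType} (U V W : normedModType R) (g : V -> W)
    (a : U -> V) u e e' d : (forall h, a (h *: e + u) = h *: e' + a u) ->
  is_derive (a u) e' g d -> is_derive u e (g \o a) d.
Proof.
move=> ae [g' <-].
by split; [rewrite (derivable_along _ ae)|rewrite (derive_along _ ae)].
Qed.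

(** [is_derive_along] asks for the derivative of the outer function in the direction of the slope of
    the phase; this reduces it to the usual derivative. *)
Lemma is_derive_scale {R : realType} (g : R -> R) (x v d : R) :
  is_derive x 1 g d -> is_derive x v g (v * d).
Proof.
move=> [g' <-]; have gx : differentiable g x by exact/derivable1_diffP.
by split; [exact: diff_derivable|rewrite deriveE// deriv1E// derive1E].
Qed.

Lemma cos_lipschitz {R : realType} (x y : R) : `|cos x - cos y| <= `|x - y|.
Proof.
wlog xy : x y / x < y.
  move=> h; have [/h//|/h|->] := ltgtP x y; last by rewrite !subrr.
  by rewrite distrC (distrC x).
rewrite distrC [leRHS]distrC.
have [|z _ ->] := @MVT R cos (fun z => - sin z) x y xy (fun z _ => is_derive_cos z).
  by apply: continuous_subspaceT => z; exact: continuous_cos.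
rewrite normrM normrN ler_piMl// ler_norml sin_geN1 sin_le1//.
Qed.

Section dotp_theory.
Context {R : realType} {n : nat}.
Implicit Types u v x y t : 'rV[R]_n.

Lemma dotpC u v : dotp u v = dotp v u.
Proof. by apply: eq_bigr => i _; rewrite mulrC. Qed.

Lemma dotpDl u v x : dotp (u + v) x = dotp u x + dotp v x.
Proof. by rewrite -big_split/=; apply: eq_bigr => i _; rewrite mxE mulrDl. Qed.

Lemma dotpZl (a : R) u x : dotp (a *: u) x = a * dotp u x.
Proof. by rewrite mulr_sumr; apply: eq_bigr => i _; rewrite mxE mulrA. Qed.

Lemma dotpNl u x : dotp (- u) x = - dotp u x.
Proof. by rewrite -scaleN1r dotpZl mulN1r. Qed.

Lemma dotpDr u x y : dotp u (x + y) = dotp u x + dotp u y.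
Proof. by rewrite dotpC dotpDl !(dotpC u). Qed.

Lemma dotpZr (a : R) u x : dotp u (a *: x) = a * dotp u x.
Proof. by rewrite dotpC dotpZl dotpC. Qed.

Lemma dotpNr u x : dotp u (- x) = - dotp u x.
Proof. by rewrite dotpC dotpNl dotpC. Qed.

Lemma dotp_delta u j : dotp u (delta_mx ord0 j) = u ord0 j.
Proof.
rewrite /dotp (bigD1 j)//= big1 ?addr0 ?mxE ?eqxx ?mulr1// => i ij.
by rewrite mxE (negbTE ij) andbF mulr0.
Qed.

Lemma Ck_dotp k x (c : R) t0 : Ck k (fun t => dotp (t - t0) x + c).
Proof.
under eq_fun do rewrite dotpDl -addrA.
apply: CkD; last exact: Ck_cst.
by apply: Ck_sum => i; apply: CkM; [exact: Ck_coord|exact: Ck_cst].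
Qed.

Lemma continuous_dotp u : continuous (dotp u).
Proof.
rewrite (_ : dotp u = fun x => dotp (x - 0) u + 0).
  exact: (Ck_continuous (Ck_dotp 0 u 0 0)).
by apply/funext => x; rewrite subr0 addr0 dotpC.
Qed.

(** [|x|] is the sup norm, which is why the l^1 norm of [u] appears. *)
Lemma norm_dotp_le u x : `|dotp u x| <= (\sum_(i < n) `|u ord0 i|) * `|x|.
Proof.
rewrite (le_trans (ler_norm_sum _ _ _))// mulr_suml ler_sum// => i _.
rewrite normrM ler_wpM2l// [leRHS]/Num.norm/= mx_normrE.
exact: (@le_bigmax _ _ _ 0 (fun ij => `|x ij.1 ij.2|) (ord0, i)).
Qed.

End dotp_theory.

(** * Oscillatory integrals: decay, regularity and vanishing of their integrals *)

Section oscillatory_integral.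
Context {R : realType} {n : nat} (t0 : 'rV[R]_n).
Implicit Types (a : 'rV[R]_n -> R) (x t : 'rV[R]_n) (c : R) (j : 'I_n).

(* The phase [c] makes a single family of the cosine and sine integrals: its
   derivatives and its products by coordinates only shift [c] by [pi / 2]. *)
Definition osc c a x : R :=
  \int[lebesgue_rV n]_t (cos (dotp (t - t0) x + c) * a t).

Let e j : 'rV[R]_n := delta_mx ord0 j.

Lemma continuous_osc_fun c a x :
  continuous a -> continuous (fun t => cos (dotp (t - t0) x + c) * a t).
Proof.
move=> ca; apply: continuous_Mf => // t.
have cp : continuous (fun t => dotp (t - t0) x + c) :=
  Ck_continuous (Ck_dotp 0 x c t0).
exact: (continuous_comp (cp t) (@continuous_cos _ _)).
Qed.

Lemma decaying_osc_fun c a x :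
  decaying a -> decaying (fun t => cos (dotp (t - t0) x + c) * a t).
Proof.
move=> [C aC]; exists C => t; rewrite (le_trans _ (aC t))//.
by rewrite normrM ler_piMl// cos_max.
Qed.

Lemma continuous_decaying_integrable a : continuous a -> decaying a ->
  (lebesgue_rV n).-integrable setT (EFin \o a).
Proof. by move=> ca; apply: decaying_integrable; exact: continuous_measurable_rV. Qed.

Lemma integrable_osc_fun c a x : continuous a -> decaying a ->
  (lebesgue_rV n).-integrable setT
    (EFin \o (fun t => cos (dotp (t - t0) x + c) * a t)).
Proof.
move=> ca da; apply: continuous_decaying_integrable.
  exact: continuous_osc_fun.
exact: decaying_osc_fun.
Qed.

Lemma oscZ c (r : R) a x : continuous a -> decaying a ->
  osc c (fun t => r * a t) x = r * osc c a x.
Proof.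
move=> ca da; rewrite -RintegralZl//; last exact: integrable_osc_fun.
by apply: eq_Rintegral => t _; rewrite mulrCA.
Qed.

Lemma oscD c a b x : continuous a -> decaying a -> continuous b -> decaying b ->
  osc c (fun t => a t + b t) x = osc c a x + osc c b x.
Proof.
move=> ca da cb db; rewrite /osc -RintegralD//; try exact: integrable_osc_fun.
by apply: eq_Rintegral => t _; rewrite mulrDr.
Qed.

Lemma oscB c a b x : continuous a -> decaying a -> continuous b -> decaying b ->
  osc c (fun t => a t - b t) x = osc c a x - osc c b x.
Proof.
move=> ca da cb db; rewrite /osc -RintegralB//; try exact: integrable_osc_fun.
by apply: eq_Rintegral => t _; rewrite mulrBr.
Qed.

Lemma oscDpi c a x : continuous a -> decaying a -> osc (c + pi) a x = - osc c a x.
Proof.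
move=> ca da; rewrite -mulN1r -oscZ//; apply: eq_Rintegral => t _.
by rewrite addrA cosDpi mulrCA mulN1r mulNr.
Qed.

Lemma le_norm_osc c a x : continuous a -> decaying a ->
  `|osc c a x| <= \int[lebesgue_rV n]_t `|a t|.
Proof.
move=> ca da; have inta := continuous_decaying_integrable ca da.
have intc := integrable_osc_fun c x ca da.
apply: le_trans (le_normr_Rintegral measurableT intc) _.
apply: le_Rintegral => //; [exact: integrable_norm|exact: integrable_norm|].
by move=> t _; rewrite normrM ler_piMl// cos_max.
Qed.

(** Integration by parts: the derivative of cos(p(t)) a(t) along coordinate [j] has integral 0, and
    differentiating the cosine brings out x_j and a phase shift of pi/2. *)
Lemma osc_mul_coord c a x j : test_fun a ->
  x ord0 j * osc (c + pi / 2) a x = - osc c ('D_(e j) a) x.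
Proof.
move=> ta; have [Ca _] := ta.
have [ca da] := (test_fun_continuous ta, test_fun_decaying ta).
have ta' := test_fun_derive j ta.
have [ca' da'] := (test_fun_continuous ta', test_fun_decaying ta').
pose p t := dotp (t - t0) x + c.
pose g t := cos (p t) * a t.
pose g' t := x ord0 j * (cos (dotp (t - t0) x + (c + pi / 2)) * a t) +
  cos (p t) * 'D_(e j) a t.
have gE t : is_derive t (e j) g (g' t).
  apply: is_derive_eq.
    apply: is_derive_mulf; last exact: (Ck_is_derive (Ca 1%N)).
    apply: (@is_derive_along _ _ _ _ cos p _ _ (x ord0 j)).
      move=> h; rewrite /p -[h *: _ + t - t0]addrA (dotpDl (h *: e j)) dotpZl.
      by rewrite [dotp (e j) x]dotpC dotp_delta -addrA.
    exact: is_derive_scale (is_derive_cos _).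
  by rewrite /g' addrA cosDpihalf; ring.
have Dg : 'D_(e j) g = g' by apply/funext => t; have [_ ->] := gE t.
have intg : (\int[lebesgue_rV n]_t (g' t)%:E = 0)%E.
  rewrite -Dg; apply: integral_derive.
  - by move=> t; have [] := gE t.
  - rewrite Dg; apply: continuous_Df; last exact: continuous_osc_fun.
    apply: continuous_Mf; first exact: cst_continuous.
    exact: continuous_osc_fun.
  - exact: decaying_osc_fun.
  - have [C1 h1] := decaying_osc_fun (c + pi / 2) x da.
    have [C2 h2] := decaying_osc_fun c x da'.
    rewrite Dg; exists (`|x ord0 j| * C1 + C2) => t.
    rewrite mulrDl (le_trans (ler_normD _ _))// lerD ?h2//.
    by rewrite normrM -mulrA ler_wpM2l.
apply/eqP; rewrite -addr_eq0; apply/eqP.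
rewrite -RintegralZl//; last exact: integrable_osc_fun.
rewrite -RintegralD//.
- by rewrite /Rintegral intg.
- apply: (integrableZl measurableT (x ord0 j)
    (integrable_osc_fun (c + pi / 2) x ca da)).
- exact: integrable_osc_fun.
Qed.

(** Two integrations by parts shift the phase by pi, that is, change the sign; so multiplication by
    x_j^2 amounts to applying minus the second derivative to [a]. *)
Lemma osc_mul_oneDsqr c a x j : test_fun a ->
  oneDsqr (x ord0 j) * osc c a x =
  osc c (fun t => a t - 'D_(e j) ('D_(e j) a) t) x.
Proof.
move=> ta; have ta' := test_fun_derive j ta; have ta'' := test_fun_derive j ta'.
have [ca da] := (test_fun_continuous ta, test_fun_decaying ta).
have [ca'' da''] := (test_fun_continuous ta'', test_fun_decaying ta'').
rewrite oscB// -[osc c ('D__ _) x]opprK -osc_mul_coord// -mulrN -osc_mul_coord//.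
rewrite (_ : c + pi / 2 + pi / 2 = c + pi); last by field.
by rewrite oscDpi// /oneDsqr; ring.
Qed.

(** Multiplying by all factors 1 + x_j^2, the inverse of the weight, yields the oscillatory integral
    of another test function [b], which is bounded by the integral of [|b|]. *)
Lemma decaying_osc c a : test_fun a -> decaying (osc c a).
Proof.
move=> ta.
suff [b [tb bE]] : exists b, test_fun b /\
    forall x, (\prod_(j < n) oneDsqr (x ord0 j)) * osc c a x = osc c b x.
  have [cb db] := (test_fun_continuous tb, test_fun_decaying tb).
  exists (\int[lebesgue_rV n]_t `|b t|) => x.
  rewrite /weight prodfV ler_pdivlMr; last first.
    by apply: prodr_gt0 => i _; rewrite (lt_le_trans ltr01 (oneDsqr_ge1 _)).
  rewrite -[X in _ * X]ger0_norm; last first.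
    by apply: prodr_ge0 => i _; rewrite (le_trans ler01 (oneDsqr_ge1 _)).
  by rewrite -normrM mulrC bE le_norm_osc.
(* Generalized to any list of coordinates; each one applies 1 - D_j^2 to the test function obtained
   so far. *)
elim: (index_enum _) => [|j r [b [tb bE]]].
  by exists a; split => // x; rewrite big_nil mul1r.
exists (fun t => b t - 'D_(e j) ('D_(e j) b) t); split.
  by apply: test_funB => //; do 2 apply: test_fun_derive.
by move=> x; rewrite big_cons -mulrA bE osc_mul_oneDsqr.
Qed.

Lemma Ck_coordB k j : Ck k (fun t => (t - t0) ord0 j).
Proof.
rewrite (_ : (fun _ => _) = fun t => t ord0 j + - t0 ord0 j).
  by apply: CkD; [exact: Ck_coord|exact: Ck_cst].
by apply/funext => t; rewrite !mxE.
Qed.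

Lemma is_derive_osc_fun c x t j (y : R) :
  is_derive y 1 (fun y => cos (dotp (t - t0) (y *: e j + x) + c))
    ((t - t0) ord0 j * cos (dotp (t - t0) (y *: e j + x) + (c + pi / 2))).
Proof.
rewrite addrA cosDpihalf; apply: (@is_derive_along _ _ _ _ cos
    (fun y : R => dotp (t - t0) (y *: e j + x) + c) y 1 ((t - t0) ord0 j)).
  move=> h; rewrite !dotpDr !dotpZr dotp_delta /GRing.scale/= mulr1; ring.
exact: is_derive_scale (is_derive_cos _).
Qed.

(** Differentiation under the integral sign: the integrand's derivative is dominated by |(t - t0)_j
    a(t)|, uniformly in the parameter. *)
Lemma is_derive_osc c a x j : test_fun a ->
  is_derive x (e j) (osc c a) (osc (c + pi / 2) (fun t => (t - t0) ord0 j * a t) x).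
Proof.
move=> ta; have [ca da] := (test_fun_continuous ta, test_fun_decaying ta).
have tb : test_fun (fun t => (t - t0) ord0 j * a t).
  by apply: test_funM ta => k; exact: Ck_coordB.
have [cb db] := (test_fun_continuous tb, test_fun_decaying tb).
(* The line x + y e_j is parametrized by [y] in ]-1, 1[, and the derivative is taken at y = 0. *)
pose f (y : R) t := cos (dotp (t - t0) (y *: e j + x) + c) * a t.
pose G t : R := `|(t - t0) ord0 j * a t|.
have f' (y : R) t : is_derive y 1 (f ^~ t)
    (cos (dotp (t - t0) (y *: e j + x) + (c + pi / 2)) * ((t - t0) ord0 j * a t)).
  apply: is_derive_eq.
    by apply: is_derive_mulf; exact: is_derive_osc_fun.
  by rewrite /=; ring.
have d1f y t : partial1of2 f y t =
    cos (dotp (t - t0) (y *: e j + x) + (c + pi / 2)) * ((t - t0) ord0 j * a t).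
  by rewrite partial1of2E; have [_ ->] := f' y t.
have I0 : `](-1 : R), 1[%classic 0 by rewrite /= in_itv/= ltrN10 ltr01.
have intf y : `](-1 : R), 1[%classic y ->
    (lebesgue_rV n).-integrable setT (EFin \o f y).
  by move=> _; exact: integrable_osc_fun.
have df y t : `](-1 : R), 1[%classic y -> setT t -> derivable (f ^~ t) y 1.
  by move=> _ _; have [] := f' y t.
have intG : (lebesgue_rV n).-integrable setT (EFin \o G).
  exact/integrable_norm/continuous_decaying_integrable.
have G_ub y t : `](-1 : R), 1[%classic y -> setT t -> `|partial1of2 f y t| <= G t.
  by move=> _ _; rewrite d1f normrM ler_piMl// cos_max.
have G0 t : 0 <= G t by exact: normr_ge0.
have ae (h : R) : (h *: (1 : R) + 0) *: e j + x = h *: e j + (0 *: e j + x).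
  by rewrite [h *: 1]mulr1 addr0 scale0r add0r.
have dF := derivable_under_integral measurableT I0 intf df G0 intG G_ub.
have F' := differentiation_under_integral measurableT I0 intf df G0 intG G_ub.
have := @derivable_along _ _ _ _ (osc c a) (fun y : R => y *: e j + x) _ _ _ ae.
have := @derive_along _ _ _ _ (osc c a) (fun y : R => y *: e j + x) _ _ _ ae.
rewrite scale0r add0r => D1 D2; split; first by rewrite -D2; exact: dF.
rewrite -D1 -derive1E; apply: (etrans F'); apply: eq_Rintegral => t _.
by rewrite d1f scale0r add0r.
Qed.

(** The cosine is 1-Lipschitz, so the integrands at [x] and [y] differ by at most w(t) |a(t)| |x -
    y|; integration gives a Lipschitz bound. *)
Lemma continuous_osc c a : test_fun a -> continuous (osc c a).
Proof.
move=> ta; have [ca da] := (test_fun_continuous ta, test_fun_decaying ta).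
pose w t := \sum_(i < n) `|(t - t0) ord0 i|.
have cw : continuous w.
  rewrite /w; elim: (index_enum _) => [|i r IH].
    by under eq_fun do rewrite big_nil; exact: cst_continuous.
  under eq_fun do rewrite big_cons; apply: continuous_Df => // t.
  have ci : continuous (fun t => (t - t0) ord0 i).
    exact: (Ck_continuous (Ck_coordB 0 i)).
  exact: (continuous_comp (ci t) (@norm_continuous _ _ _)).
have cwa : continuous (fun t => w t * a t) by exact: continuous_Mf.
have dwa : decaying (fun t => w t * a t).
  apply: bounded_support_decaying => //; have [_ [M aM]] := ta.
  by exists M => t /aM ->; rewrite mulr0.
have intwa := integrable_norm (continuous_decaying_integrable cwa dwa).
pose L := \int[lebesgue_rV n]_t `|w t * a t|.
have lip x y : `|osc c a x - osc c a y| <= L * `|x - y|.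
  have [intx inty] := (integrable_osc_fun c x ca da, integrable_osc_fun c y ca da).
  have intxy := integrableB measurableT intx inty.
  rewrite /osc -RintegralB//; apply: le_trans (le_normr_Rintegral measurableT intxy) _.
  rewrite /L -RintegralZr//; apply: le_Rintegral => //.
  - exact: integrable_norm.
  - exact: (integrableZr measurableT _ intwa).
  - move=> t _; rewrite -mulrBl !normrM mulrAC ler_wpM2r//.
    rewrite (le_trans (cos_lipschitz _ _))//.
    rewrite opprD addrACA subrr addr0 -dotpNr -dotpDr.
    by rewrite (le_trans (norm_dotp_le _ _))// ler_wpM2r// ler_norm.
move=> x; apply/(@cvgrPdist_lt _ _ _ (nbhs x) (nbhs_filter x)) => eps eps0.
(* Adding 1 keeps the divisor positive when [L] is 0. *)
have L0 : 0 < `|L| + 1 by rewrite ltr_wpDl.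
apply/nbhs_ballP; exists (eps / (`|L| + 1)); first exact: divr_gt0.
move=> y; rewrite -ball_normE/= => xy; rewrite (le_lt_trans (lip x y))//.
rewrite (@le_lt_trans _ _ ((`|L| + 1) * `|x - y|))//.
  by rewrite ler_wpM2r// (le_trans (ler_norm _))// lerDl.
by rewrite mulrC -ltr_pdivlMr.
Qed.

Lemma integrable_osc c a : test_fun a ->
  (lebesgue_rV n).-integrable setT (EFin \o osc c a).
Proof.
move=> ta; apply: continuous_decaying_integrable.
  exact: continuous_osc.
exact: decaying_osc.
Qed.

(** The integrand is the derivative along coordinate [j] of [osc (c - pi / 2) a]; starting from the
    phase c - pi/2 makes the derivative land on [c]. Both functions decay, so [integral_derive]
    applies. *)
Lemma integral_osc_mul_coord c a j : test_fun a ->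
  (\int[lebesgue_rV n]_x (osc c (fun t => (t - t0) ord0 j * a t) x)%:E = 0)%E.
Proof.
move=> ta; have tb : test_fun (fun t => (t - t0) ord0 j * a t).
  by apply: test_funM ta => k; exact: Ck_coordB.
have D x := is_derive_osc (c - pi / 2) x j ta.
have DE : 'D_(e j) (osc (c - pi / 2) a) =
    osc c (fun t => (t - t0) ord0 j * a t).
  by apply/funext => x; have [_ ->] := D x; rewrite subrK.
rewrite -DE; apply: integral_derive; rewrite ?DE.
- by move=> x; have [] := D x.
- exact: continuous_osc.
- exact: decaying_osc.
- exact: decaying_osc.
Qed.

(* On the support of [a] one can divide by the linear form [(t - t0) . u], which
   turns [osc c a] into the directional derivative along [u] of an integrable
   function. *)
Lemma integral_osc_eq0 c a u : test_fun a ->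
  (forall t, dotp (t - t0) u = 0 -> \forall t' \near t, a t' = 0) ->
  \int[lebesgue_rV n]_x osc c a x = 0.
Proof.
move=> ta a0.
pose s t := dotp (t - t0) u.
have Cs k : Ck k s.
  rewrite (_ : s = fun t => dotp (t - t0) u + 0); first exact: Ck_dotp.
  by apply/funext => t; rewrite addr0.
have tq : test_fun (fun t => a t / s t) by exact: test_fun_div.
pose F j t := (t - t0) ord0 j * (u ord0 j * (a t / s t)).
have tuq j : test_fun (fun t => u ord0 j * (a t / s t)).
  by apply: test_funM => // k; exact: Ck_cst.
have tF j : test_fun (F j).
  by apply: test_funM => // k; exact: Ck_coordB.
(* The sum of the (t - t0)_j u_j is s(t), which cancels the denominator; where s(t) = 0, both sides
   are 0. Each summand has the form treated by [integral_osc_mul_coord]. *)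
have aE : a = fun t => \sum_(j < n) F j t.
  apply/funext => t; rewrite /F.
  under eq_bigr do rewrite mulrA.
  rewrite -mulr_suml -/(s t).
  have [st0|st0] := eqVneq (s t) 0; last by rewrite mulrCA mulfV ?mulr1.
  by rewrite (nbhs_singleton (a0 t st0)) mul0r mulr0.
(* Being a test function is carried through the induction on the list, since splitting the integral
   of a sum requires integrability of the partial sums. *)
suff [] : test_fun (fun t => \sum_(j < n) F j t) /\
    (\int[lebesgue_rV n]_x (osc c (fun t => \sum_(j < n) F j t) x)%:E = 0)%E.
  by rewrite /Rintegral aE => _ ->.
elim: (index_enum _) => [|j r [tr IH]].
  under [X in test_fun X]eq_fun do rewrite big_nil.
  split; first by split=> [k|]; [exact: Ck_cst|exists 0].
  apply: integral0_eq => x _; rewrite /osc.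
  under eq_Rintegral do rewrite big_nil mulr0.
  by rewrite /Rintegral integral0.
under [X in test_fun X]eq_fun do rewrite big_cons.
split; first exact: test_funD.
have [cF dF] := (test_fun_continuous (tF j), test_fun_decaying (tF j)).
have [cr dr] := (test_fun_continuous tr, test_fun_decaying tr).
transitivity (\int[lebesgue_rV n]_x ((osc c (F j) x)%:E +
    (osc c (fun t => \sum_(j <- r) F j t) x)%:E))%E.
  apply: eq_integral => x _; rewrite -EFinD -oscD//; congr (osc _ _ _)%:E.
  by apply/funext => t; rewrite big_cons.
rewrite integralD//; [|exact: integrable_osc|exact: integrable_osc].
by rewrite IH integral_osc_mul_coord// adde0.
Qed.

End oscillatory_integral.

(** * Euclidean balls and the support of a test function *)

Section euclidean_ball.
Context {R : realType} {n : nat}.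
Implicit Types (u x t c : 'rV[R]_n).

Lemma dotp_ge0 u : 0 <= dotp u u.
Proof. by apply: sumr_ge0 => i _; rewrite -expr2 sqr_ge0. Qed.

Lemma norm_le_enorm u : `|u| <= enorm u.
Proof.
rewrite [leLHS]/Num.norm/= mx_normrE; apply/bigmax_leP.
split; first exact: sqrtr_ge0.
move=> [i j] _ /=; rewrite ord1 -sqrtr_sqr /enorm ler_wsqrtr// expr2.
by rewrite /dotp (bigD1 j)//= lerDl sumr_ge0// => k _; rewrite -expr2 sqr_ge0.
Qed.

(* The hyperplane through [t0] orthogonal to [c - t0] misses the balls centered
   at [c] that do not contain [t0]. *)
Lemma eball_dotp_neq0 c r t0 t : ~ eball c r t0 -> eball c r t ->
  dotp (t - t0) (c - t0) != 0.
Proof.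
move=> ct0 ct; apply/eqP => d0; apply: ct0.
apply: le_lt_trans ct; rewrite /enorm ler_wsqrtr//.
have -> : t - c = (t - t0) - (c - t0) by rewrite opprB addrA subrK.
have -> : t0 - c = - (c - t0) by rewrite opprB.
move: (t - t0) (c - t0) d0 => p q pq.
rewrite !dotpDl !dotpDr !dotpNl !dotpNr (dotpC q p) pq.
by rewrite opprK !oppr0 add0r addr0 lerDr dotp_ge0.
Qed.

End euclidean_ball.

Section test_functions.
Context {R : realType} {n : nat}.
Variables (phi : 'rV[R]_n -> R[i]) (c : 'rV[R]_n) (r : R).
Hypothesis phi_ball : supp phi `<=` eball c r.

Let phi_eq0 t : ~ eball c r t -> phi t = 0.
Proof.
move=> ct; apply/eqP/negPn/negP => phit; apply: ct.
exact/phi_ball/subset_closure.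
Qed.

(** Stated for any [a] that vanishes where [phi] does, to serve for the real and the imaginary part
    at once. *)
Lemma bounded_support_supp (a : 'rV[R]_n -> R) :
  (forall t, phi t = 0 -> a t = 0) -> bounded_support a.
Proof.
move=> phia; exists (`|c| + r) => t tcr; apply/phia/phi_eq0 => ct.
move: tcr; apply/negP; rewrite -leNgt -[t](subrK c) (le_trans (ler_normD _ _))//.
by rewrite addrC lerD2l (le_trans (norm_le_enorm _))// ltW.
Qed.

(** A point of the hyperplane is outside the ball, hence in the open complement of the support. This
    is the hypothesis of [integral_osc_eq0] for [u = c - t0]. *)
Lemma supp_near_eq0 t0 (a : 'rV[R]_n -> R) : ~ eball c r t0 ->
  (forall t, phi t = 0 -> a t = 0) ->
  forall t, dotp (t - t0) (c - t0) = 0 -> \forall t' \near t, a t' = 0.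
Proof.
move=> ct0 phia t d0.
have nt : ~ supp phi t.
  by move=> /phi_ball /(eball_dotp_neq0 ct0); rewrite d0 eqxx.
have /open_nbhs_nbhs : open_nbhs t (~` supp phi).
  by split => //; rewrite openC; exact: closed_closure.
apply: filterS => t' nt'; apply/phia/eqP/negPn/negP => phit'.
by apply: nt'; exact: subset_closure.
Qed.

Hypothesis phi_smooth : smooth phi.

Lemma test_fun_Re : test_fun (fun t => complex.Re (phi t)).
Proof.
split=> [k|]; first by have [] := phi_smooth k.
by apply: bounded_support_supp => t ->.
Qed.

Lemma test_fun_Im : test_fun (fun t => complex.Im (phi t)).
Proof.
split=> [k|]; first by have [] := phi_smooth k.
by apply: bounded_support_supp => t ->.
Qed.

End test_functions.

(** * The spectrum of the cosine *)

Section cosine.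
Context {R : realType} {n : nat}.
Implicit Types (x t : 'rV[R]_n) (a : 'rV[R]_n -> R).

(** By the product-to-sum formula, multiplying by cos(t1 . x) moves the base point from 0 to [t1]
    and [- t1]. *)
Lemma cos_mul_osc t1 c a x : test_fun a ->
  cos (dotp t1 x) * osc 0 c a x = 2^-1 * (osc t1 c a x + osc (- t1) c a x).
Proof.
move=> ta; have [ca da] := (test_fun_continuous ta, test_fun_decaying ta).
rewrite -RintegralD//; try exact: integrable_osc_fun.
rewrite -RintegralZl//; last exact: integrable_osc_fun.
rewrite -RintegralZl//; last first.
  have := integrableD measurableT (integrable_osc_fun t1 c x ca da)
    (integrable_osc_fun (- t1) c x ca da).
  by [].
apply: eq_Rintegral => t _.
rewrite subr0 opprK !dotpDl dotpNl -!(addrAC _ c) (cosD _ (- dotp t1 x)).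
by rewrite (cosD _ (dotp t1 x)) cosN sinN; field.
Qed.

(** Integrability is part of the conclusion because [spectrum_cos] splits the integral of a sum of
    two such functions. *)
Lemma integral_cos_mul_osc t1 c a : test_fun a ->
  (forall t0, t0 \in [:: t1; - t1] ->
    \int[lebesgue_rV n]_x osc t0 c a x = 0) ->
  (lebesgue_rV n).-integrable setT
    (EFin \o (fun x => cos (dotp t1 x) * osc 0 c a x)) /\
  \int[lebesgue_rV n]_x (cos (dotp t1 x) * osc 0 c a x) = 0.
Proof.
move=> ta a0; rewrite (funext (fun x => cos_mul_osc t1 c x ta)).
have i1 := integrable_osc t1 c ta; have i2 := integrable_osc (- t1) c ta.
have i12 : (lebesgue_rV n).-integrable setT
    (EFin \o (fun x => osc t1 c a x + osc (- t1) c a x)).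
  exact: (integrableD measurableT i1 i2).
split; first exact: (integrableZl measurableT 2^-1 i12).
rewrite RintegralZl// RintegralD// !a0 ?addr0 ?mulr0//.
  by rewrite !inE eqxx orbT.
by rewrite !inE eqxx.
Qed.

Lemma ReM (z w : R[i]) : complex.Re (z * w) =
  complex.Re z * complex.Re w - complex.Im z * complex.Im w.
Proof. by case: z w => [? ?] [? ?]. Qed.

Lemma ImM (z w : R[i]) : complex.Im (z * w) =
  complex.Re z * complex.Im w + complex.Im z * complex.Re w.
Proof. by case: z w => [? ?] [? ?]. Qed.

Lemma Re_realM (r : R) (z : R[i]) : complex.Re (r%:C * z) = r * complex.Re z.
Proof. by rewrite ReM/= mul0r subr0. Qed.

Lemma Im_realM (r : R) (z : R[i]) : complex.Im (r%:C * z) = r * complex.Im z.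
Proof. by rewrite ImM/= mul0r addr0. Qed.

(** The sine is written as a cosine with phase -pi/2, so that both terms are values of [osc]. *)
Lemma Re_fourier phi x (a := fun t => complex.Re (phi t))
    (b := fun t => complex.Im (phi t)) : test_fun a -> test_fun b ->
  complex.Re (fourier phi x) = osc 0 0 a x + osc 0 (- (pi / 2)) b x.
Proof.
move=> ta tb; transitivity (\int[lebesgue_rV n]_t
  complex.Re (expi (- dotp t x) * phi t)) => //.
rewrite /osc -RintegralD//.
- apply: eq_Rintegral => t _; rewrite ReM/= subr0 addr0 cosBpihalf cosN sinN.
  by rewrite mulNr opprK.
- exact: integrable_osc_fun (test_fun_continuous ta) (test_fun_decaying ta).
- exact: integrable_osc_fun (test_fun_continuous tb) (test_fun_decaying tb).
Qed.

Lemma Im_fourier phi x (a := fun t => complex.Re (phi t))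
    (b := fun t => complex.Im (phi t)) : test_fun a -> test_fun b ->
  complex.Im (fourier phi x) = osc 0 0 b x - osc 0 (- (pi / 2)) a x.
Proof.
move=> ta tb; transitivity (\int[lebesgue_rV n]_t
  complex.Im (expi (- dotp t x) * phi t)) => //.
rewrite /osc -RintegralB//.
- apply: eq_Rintegral => t _; rewrite ImM/= subr0 addr0 cosBpihalf cosN sinN.
  by rewrite mulNr.
- exact: integrable_osc_fun (test_fun_continuous tb) (test_fun_decaying tb).
- exact: integrable_osc_fun (test_fun_continuous ta) (test_fun_decaying ta).
Qed.

Lemma spectrum_cos (K : set 'rV[R]_n) t1 : K t1 -> K (- t1) ->
  spectrum_in K (fun x => (cos (dotp t1 x))%:C).
Proof.
move=> Kt1 KNt1 phi sphi [c [r [r0 phic cK]]].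
have [tR tI] := (test_fun_Re phic sphi, test_fun_Im phic sphi).
have out t0 : t0 \in [:: t1; - t1] -> ~ eball c r t0.
  move=> t0t1 ct0; suff : (eball c r `&` K) t0 by rewrite cK.
  by split => //; move: t0t1; rewrite !inE => /orP[]/eqP ->.
(* Used four times: for the real and the imaginary part of [phi], with phases 0 and -pi/2. *)
have vanish d a : test_fun a -> (forall t, phi t = 0 -> a t = 0) ->
    (lebesgue_rV n).-integrable setT
      (EFin \o (fun x => cos (dotp t1 x) * osc 0 d a x)) /\
    \int[lebesgue_rV n]_x (cos (dotp t1 x) * osc 0 d a x) = 0.
  move=> ta phia; apply: integral_cos_mul_osc => // t0 /out ct0.
  exact: integral_osc_eq0 ta (supp_near_eq0 phic ct0 phia).
have vR d := vanish d _ tR (fun t phit => congr1 (@complex.Re R) phit).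
have vI d := vanish d _ tI (fun t phit => congr1 (@complex.Im R) phit).
rewrite /cintegral (_ : 0 = 0 +i* 0)//; congr (_ +i* _).
- under eq_Rintegral do rewrite Re_realM Re_fourier// mulrDr.
  have [[i1 v1] [i2 v2]] := (vR 0, vI (- (pi / 2))).
  by rewrite RintegralD// v1 v2 addr0.
- under eq_Rintegral do rewrite Im_realM Im_fourier// mulrBr.
  have [[i1 v1] [i2 v2]] := (vI 0, vR (- (pi / 2))).
  by rewrite RintegralB// v1 v2 subr0.
Qed.

End cosine.

Lemma normc_real {R : rcfType} (x : R) : `|x%:C| = `|x|%:C.
Proof. by rewrite normc_def/= expr0n addr0 sqrtr_sqr. Qed.

Lemma bernstein_cos {R : realType} n (K : set 'rV[R]_n) t1 : K t1 -> K (- t1) ->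
  bernstein K (fun x => (cos (dotp t1 x))%:C).
Proof.
move=> Kt1 KNt1; split; last exact: spectrum_cos.
  move=> x; apply/(@cvgrPdist_lt _ _ _ (nbhs x) (nbhs_filter x)) => eps eps0.
  (* Here [eps] is an element of [R[i]]; being positive in its partial order forces its imaginary
     part to be 0. *)
  have epsE : eps = (complex.Re eps)%:C.
    by case: eps eps0 => a b; rewrite ltcE/= => /andP[/eqP -> _].
  have Reps0 : 0 < complex.Re eps by move: eps0; rewrite epsE ltcR.
  have cc : continuous (fun x => cos (dotp t1 x)).
    move=> y.
    exact: (continuous_comp (@continuous_dotp _ _ t1 y) (@continuous_cos _ _)).
  have /(@cvgrPdist_lt _ _ _ (nbhs x) (nbhs_filter x))/(_ _ Reps0) := cc x.
  apply: filterS => y; rewrite epsE -ltcR.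
  by rewrite -rmorphB normc_real.
by exists 1 => x; rewrite normc_real lecR cos_max.
Qed.

(** * The polar gauge as support function, and the covering by translates of [S] *)

(** The polar gauge is the support function of [K]: for a > 0, [x] lies in [a] times the polar body
    exactly when the maximum of t . x over [K] is at most [a]. Compactness provides a maximizer. *)
Lemma gauge_norm_polar {R : realType} n (K : set 'rV[R]_n) (x : 'rV[R]_n) :
  convex_symmetric_body K -> 0 < gauge_norm (polar K) x ->
  exists2 t, K t & dotp t x = gauge_norm (polar K) x.
Proof.
move=> [cK _ [k0 /interior_subset Kk0] KN] g0.
have [||t tK tmax] := @compact_EVT_max _ _ (fun t => dotp t x) K _ cK.
- by exists k0.
- apply: continuous_subspaceT.
  by under eq_fun do rewrite dotpC; exact: continuous_dotp.
rewrite inE in tK; exists t => //.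
have mx (a : R) : 0 < a -> scale_set a (polar K) x <-> dotp t x <= a.
  move=> a0; split=> [[y yK <-]|ta].
    by rewrite dotpZr ger_pMr// dotpC; exact: yK.
  exists (a^-1 *: x); last by rewrite scalerA mulfV ?gt_eqF// scale1r.
  move=> s Ks; rewrite dotpZl ler_pdivrMl// mulr1 dotpC.
  by rewrite (le_trans _ ta)// tmax// inE.
(* By symmetry - t competes with the maximizer [t]. *)
have t0 : 0 <= dotp t x.
  have : K (- t) by rewrite KN; exists t.
  by move=> /mem_set/tmax; rewrite dotpNl; lra.
(* If the maximum is 0, every a > 0 is admissible and the gauge is 0, contrary to [g0]; otherwise
   the admissible [a] form a closed half line starting at the maximum. *)
have [t0'|t0'] := eqVneq (dotp t x) 0.
  move: g0; rewrite /gauge_norm.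
  suff -> : [set a : R | 0 < a /\ scale_set a (polar K) x] = `]0, +oo[%classic.
    by rewrite inf_itv ?ltxx//.
  apply/seteqP; split => a /=; rewrite in_itv/= andbT; first by case.
  by move=> a0; split => //; apply/mx => //; rewrite t0' ltW.
rewrite /gauge_norm.
suff -> : [set a : R | 0 < a /\ scale_set a (polar K) x] =
    `[dotp t x, +oo[%classic by rewrite inf_itv.
apply/seteqP; split => a /=; rewrite in_itv/= andbT.
  by move=> [a0 /mx]; exact.
move=> ta; have a0 : 0 < a by rewrite (lt_le_trans _ ta)// lt_neqAle eq_sym t0'.
by split => //; apply/mx.
Qed.

(** s x is the convex combination of x and -x with weights (1 + s)/2 and (1 - s)/2. *)
Lemma convex_symmetric_segment {R : realType} n (S : set 'rV[R]_n) x (s : R) :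
  convex_symmetric_body S -> S x -> -1 <= s <= 1 -> S (s *: x).
Proof.
move=> [_ cS _ SN] Sx /andP[s1 s2].
have SNx : S (- x) by rewrite SN; exists x.
have h01 : 0 <= (1 + s) / 2 <= 1 by apply/andP; split; lra.
have := cS x (- x) (Itv01 (proj1 (andP h01)) (proj2 (andP h01)))
  (mem_set Sx) (mem_set SNx).
rewrite inE.
have -> : s *: x = ((1 + s) / 2) *: x + (1 - (1 + s) / 2) *: - x.
  by rewrite scalerN -scalerBl; congr (_ *: _); field.
by [].
Qed.

Theorem proposition1 (R : realType) (n : nat) (n_ge1 : (1 <= n)%N)
    (K : set 'rV[R]_n) (K_body : convex_symmetric_body K)
    (K_pos : (0 < lebesgue_rV n K)%E)
    (S : set 'rV[R]_n) (S_body : convex_symmetric_body S)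
    (S_x0 : exists x0, S x0 /\ gauge_norm (polar K) x0 = pi / 2) :
  exists (Lambda : set 'rV[R]_n) (f : 'rV[R]_n -> R[i]),
    [/\ sum_set Lambda S = setT,
        bernstein K f,
        exists x, f x != 0 &
        forall x, Lambda x -> f x = 0].
Proof.
have [x0 [Sx0 x0E]] := S_x0.
have pihalf_gt0 : 0 < pi / 2 :> R by rewrite divr_gt0// pi_gt0.
have [|t1 Kt1 t1x0] := @gauge_norm_polar _ _ K x0 K_body; first by rewrite x0E.
rewrite x0E in t1x0.
have KNt1 : K (- t1) by have [_ _ _ ->] := K_body; exists t1.
exists [set x | cos (dotp t1 x) = 0], (fun x => (cos (dotp t1 x))%:C); split.
- apply/seteqP; split => // x _.
  (* g(s) is the value of the cosine at x - s x0. With theta = t1 . x, it is -sin theta at s = -1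
     and sin theta at s = 1, so 0 lies between the end values. *)
  pose g (s : R) := cos (dotp t1 x - s * (pi / 2)).
  have cg : continuous g.
    move=> s; apply: continuous_comp; last exact: continuous_cos.
    apply: cvgB; first exact: cvg_cst.
    by apply: cvgM; [exact: cvg_id|exact: cvg_cst].
  have [|||s s11 gs0] := @IVT R g (-1) 1 0.
  + exact: le_trans (lerN10 R) ler01.
  + exact: continuous_subspaceT.
  + rewrite /g mul1r mulN1r opprK cosDpihalf cosBpihalf.
    by rewrite ge_min le_max; case: (leP 0 (sin (dotp t1 x))); lra.
  exists (x - s *: x0).
    by rewrite /= dotpDr dotpNr dotpZr t1x0.
  exists (s *: x0); last by rewrite subrK.
  exact: convex_symmetric_segment.
- exact: bernstein_cos.
- exists 0; rewrite (_ : dotp t1 0 = 0) ?cos0 ?oner_neq0//.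
  by rewrite -(scale0r (0 : 'rV[R]_n)) dotpZr mul0r.
- by move=> x /= ->.
Qed.
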